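(* For every nonzero real number $x$, $$\left.\frac{\partial W_{\alpha,\beta}(x)}{\partial\alpha}\right|_{\alpha=\beta=1}=\frac{\sqrt x\left[2K_1(2\sqrt x)-\ln x\,I_1(2\sqrt x)\right]-I_0(2\sqrt x)}{2}.$$
   Context: The Wright function is $W_{\alpha,\beta}(x)=\sum_{k=0}^\infty\frac{x^k}{k!\,\Gamma(\alpha k+\beta)}$ (with $1/\Gamma=0$ at the poles of $\Gamma$), so that $\frac{\partial W_{\alpha,\beta}(x)}{\partial\alpha}=-\sum_{k=1}^\infty\frac{\psi(\alpha k+\beta)}{k!\,\Gamma(\alpha k+\beta)}\,k\,x^k$, with $\psi=\Gamma'/\Gamma$ the digamma function. $I_\nu$ and $K_\nu$ are the modified Bessel functions of the first and second kind. For $x<0$, $\ln x$ and $\sqrt x$ denote principal branches. *)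

(* Defs.v *)
From HB Require Import structures.
From mathcomp Require Import all_boot all_order all_algebra.
From mathcomp Require Import complex.
From mathcomp Require Import all_classical all_reals all_analysis.

Set Implicit Arguments.
Unset Strict Implicit.
Unset Printing Implicit Defensive.

Import Order.TTheory GRing.Theory Num.Theory.
Import numFieldNormedType.Exports.

Local Open Scope classical_set_scope.
Local Open Scope ring_scope.
Local Open Scope complex_scope.

Section SpecialFunctions.
Context {R : realType}.
Implicit Types (x a b nu : R) (z : R[i]).

Definition Gamma_integral x : R :=
  (\int[@lebesgue_measure R]_(t in `]0%R, +oo[) (t `^ (x - 1) * expR (- t)))%R.

(* For x <= 0, Gamma x is Gamma (x + n) / (x (x + 1) ... (x + n - 1)) with n
   the least natural number such that 0 < x + n. At a pole x = 0, -1, -2, ...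
   the denominator vanishes, so that Gamma x = 0 and hence (Gamma x)^-1 = 0,
   which is the conventional value of 1 / Gamma there. *)
Definition Gamma x : R :=
  if 0 < x then Gamma_integral x
  else let n := (Num.truncn (- x)).+1 in
       Gamma_integral (x + n%:R) / \prod_(j < n) (x + j%:R).

Definition wright a b x : R :=
  limn (series (fun k : nat => x ^+ k / (k`!%:R * Gamma (a * k%:R + b)))).

(* Principal argument, in ]-pi, pi] for z != 0. *)
Definition Argc z : R :=
  let t := acos (complex.Re z / Normc.normc z) in
  if 0 <= complex.Im z then t else - t.

Definition lnc z : R[i] := ln (Normc.normc z) +i* Argc z.

Definition expc z : R[i] :=
  (expR (complex.Re z))%:C * (cos (complex.Im z) +i* sin (complex.Im z)).

(* Principal branch. The principal square root is the library's sqrtc. *)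
Definition powc z nu : R[i] :=
  if z == 0 then (nu == 0)%:R else expc (nu%:C * lnc z).

(* R[i]^o carries the topology given by the modulus. *)
Definition besselI nu z : R[i] :=
  powc (z / 2) nu *
  limn (series (fun k : nat =>
    (z / 2) ^+ (2 * k) / (k`!%:R * (Gamma (nu + k%:R + 1))%:C) : R[i]^o)).

Definition besselK_formula nu z : R[i] :=
  (pi / 2)%:C * (besselI (- nu) z - besselI nu z) / (sin (nu * pi))%:C.

Definition besselK nu z : R[i] :=
  if nu \is a Num.int
  then lim ((besselK_formula mu z : R[i]^o) @[mu --> nu^'])
  else besselK_formula nu z.

End SpecialFunctions.

(* Main.v *)
Require Import Defs.
From HB Require Import structures.
From mathcomp Require Import all_boot all_order all_algebra.
From mathcomp Require Import complex ring lra.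
From mathcomp Require Import all_classical all_reals all_analysis.
From mathcomp Require Import measurable_realfun.

Set Implicit Arguments.
Unset Strict Implicit.
Unset Printing Implicit Defensive.

Import Order.TTheory GRing.Theory Num.Theory.
Import numFieldNormedType.Exports.

Local Open Scope classical_set_scope.
Local Open Scope ring_scope.
Local Open Scope complex_scope.

(** Let [G = 1/Gamma], [c_k = x^k / k!], [s = sqrt x], [l = ln s] and
    [H nu = sum_k c_k G (nu + k + 1)].  On the real axis [ln x = 2 l] for the
    principal branches, so that [I_nu (2 s) = exp (nu l) H nu], where [H] is a
    real function of the real order [nu].

    The quotient defining [K_1 (2 s)] is an indeterminate form, because
    [H (-1) = x H 1] and [s^2 = x]; the quotient of the derivatives is
    [K_1 (2 s) = l s H 1 + (H' (-1) / s + s H' 1) / 2] ([besselK1_sqrt]).  In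
    the right-hand side of the theorem the logarithms cancel, and what remains
    is [(H' (-1) + x H' 1 - H 0) / 2].

    Let [W] be [sum_k c_k k G' (k + 1)], the derivative of the Wright function
    at [a = 1].  Shifting the index gives [x H' 1 = W]
    ([bessel_factor_deriv2]), and [G' k = G (k + 1) + k G' (k + 1)], the
    derivative of the functional equation [G y = y G (y + 1)], gives
    [H' (-1) = H 0 + W] ([bessel_factor_deriv0]).  Thus the remaining
    expression is [W].  The argument never evaluates [G'], that is, the
    digamma function.

    The analytic content is that [H] at [-1] and [1], and the Wright function
    at [1], can be differentiated term by term.  For this it suffices that [G]
    is differentiable at the natural numbers, and that its difference
    quotients there grow at most polynomially ([rgamma_lipschitz_nat]); then
    the exponential series dominates ([is_derive_rgamma_series]).
    Differentiability is established under the integral sign at the point [3]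
    and carried to the other natural numbers by the functional equation.  The
    Lipschitz bounds come from integrating elementary inequalities between
    [t^z] and [t^y], which show that Gamma is increasing with controlled
    slopes on [2, oo[. *)

(** * The Gamma integral and its functional equation *)

Section GammaIntegral.
Context {R : realType}.
Implicit Types (t y z p : R) (n : nat).

Local Notation mu := (@lebesgue_measure R).

Definition gamma_density y t : R := t `^ (y - 1) * expR (- t).

Lemma gamma_density_ge0 y t : 0 <= gamma_density y t.
Proof. by rewrite mulr_ge0 ?powR_ge0 ?expR_ge0. Qed.

Lemma measurable_gamma_density (D : set R) y : measurable D ->
  measurable_fun D (gamma_density y).
Proof.
move=> mD; apply: measurable_funM.
  by apply: measurable_funTS; exact: measurable_powR.
by apply: measurable_funTS; apply: measurableT_comp.
Qed.

Lemma cvgn_shift2 (u : R^nat) (l : R) :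
  u @ \oo --> l -> u n.+2 @[n --> \oo] --> l.
Proof.
move=> ul; rewrite (cvg_shiftS (fun n => u n.+1)).
by rewrite cvg_shiftS.
Qed.

Lemma is_derive_powRl p t : 0 < t ->
  is_derive t 1 (@powR R ^~ p) (p * t `^ (p - 1)).
Proof.
move=> t0; apply: DeriveDef.
  by apply: derivable_powR; rewrite in_itv/= t0.
by rewrite -derive1E powR_derive1// in_itv/= t0.
Qed.

Lemma is_derive_gamma_density y t : 0 < t ->
  is_derive t 1 (gamma_density (y + 1)) (y * gamma_density y t - gamma_density (y + 1) t).
Proof.
move=> t0; rewrite /gamma_density.
have ? := is_derive_powRl (y + 1 - 1) t0.
apply: is_derive_eq.
by rewrite /GRing.scale/= addrK; ring.
Qed.

Lemma continuous_gamma_density y t : 0 < t -> {for t, continuous (gamma_density y)}.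
Proof.
move=> t0; have := is_derive_gamma_density (y - 1) t0; rewrite subrK => -[h _].
exact/differentiable_continuous/derivable1_diffP.
Qed.

(** The bound [ln v <= v] at [v = t / (2 (p + 1))] leaves half of the
    exponential decay of the Gamma integrand to spare. *)
Lemma powR_le_expR_half p t : 0 <= p -> 0 < t ->
  t `^ p <= (2 * (p + 1)) `^ p * expR (t / 2).
Proof.
move=> p0 t0; have q0 : 0 < 2 * (p + 1) by lra.
rewrite /powR !gt_eqF// -expRD ler_expR.
have -> : ln t = ln (t / (2 * (p + 1))) + ln (2 * (p + 1)).
  by rewrite ln_div ?posrE// subrK.
rewrite mulrDr addrC lerD2l.
have h : ln (t / (2 * (p + 1))) <= t / (2 * (p + 1)).
  by apply: ltW; apply: ln_sublinear; rewrite divr_gt0.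
rewrite (le_trans (ler_wpM2l p0 h))//.
rewrite mulrA ler_pdivrMr//.
nra.
Qed.

Lemma integrable_gamma_density_ge1 y : 1 <= y ->
  mu.-integrable `]0, +oo[ (EFin \o gamma_density y).
Proof.
move=> y1.
pose C := (2 * (y - 1 + 1)) `^ (y - 1) * 2.
have iE : mu.-integrable `]0, +oo[ (fun t => (C%:E * (EFin \o exponential_pdf 2^-1) t)%E).
  apply: integrableZl => //.
  apply: (@integrableS _ _ _ _ setT) => //.
  by apply: integrable_exponential_pdf; rewrite invr_gt0.
apply: le_integrable iE => //.
  by apply/measurable_EFinP; apply: measurable_gamma_density; exact: measurable_itv.
move=> t /=; rewrite in_itv/= andbT => t0.
rewrite !lee_fin ger0_norm ?gamma_density_ge0// exponential_pdfE ?(ltW t0)//.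
rewrite (le_trans _ (ler_norm _))// /gamma_density /C.
set C0 := (2 * _) `^ _.
have -> : C0 * 2 * (2^-1 * expR (- 2^-1 * t)) = C0 * expR (t / 2) * expR (- t).
  rewrite -[RHS]mulrA -expRD (_ : t / 2 - t = - 2^-1 * t); last by field.
  by field.
rewrite ler_wpM2r ?expR_ge0//.
by apply: powR_le_expR_half => //; lra.
Qed.

(** A compact exhaustion of the half-line that stays away from both ends: for
    [y < 1] the integrand is unbounded at [0], so that the fundamental theorem
    of calculus has to be used away from [0]. *)
Definition gamma_box n : set R := `[n.+2%:R^-1, n.+2%:R].

Lemma gamma_boxE n t : gamma_box n t = (n.+2%:R^-1 <= t <= n.+2%:R) :> Prop.
Proof. by rewrite /gamma_box /= in_itv. Qed.

Lemma bigcup_gamma_box : \bigcup_n gamma_box n = `]0, +oo[%classic.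
Proof.
apply/seteqP; split=> t.
  case=> n _; rewrite gamma_boxE => /andP[h _].
  by rewrite /= in_itv/= andbT; apply: lt_le_trans h; rewrite invr_gt0.
rewrite /= in_itv/= andbT => t0.
(* n.+2 exceeds both t and 1 / t *)
pose n := (Num.truncn t + Num.truncn t^-1)%N.
exists n => //; rewrite gamma_boxE; apply/andP; split.
  rewrite -[leRHS]invrK lef_pV2 ?posrE ?invr_gt0//.
  by rewrite ltW// (lt_le_trans (truncnS_gt _))// ler_nat ltnS leqW// leq_addl.
by rewrite ltW// (lt_le_trans (truncnS_gt _))// ler_nat ltnS leqW// leq_addr.
Qed.

Lemma gamma_box_gt0 n t : gamma_box n t -> 0 < t.
Proof. by rewrite gamma_boxE => /andP[h _]; rewrite (lt_le_trans _ h)// invr_gt0. Qed.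

Lemma integrable_gamma_box y n : mu.-integrable (gamma_box n) (EFin \o gamma_density y).
Proof.
apply: continuous_compact_integrable; first exact: segment_compact.
apply: continuous_in_subspaceT => t /[!inE] /gamma_box_gt0 t0.
exact: continuous_gamma_density.
Qed.

(** Integration by parts, obtained by integrating the derivative of [t^y
    e^(-t)]. Both integrals are kept in the extended reals, so that the limit
    over the boxes can be taken before anything is known to be integrable. *)
Lemma gamma_box_by_parts y n :
  (y%:E * \int[mu]_(t in gamma_box n) (gamma_density y t)%:E =
   \int[mu]_(t in gamma_box n) (gamma_density (y + 1) t)%:E +
   (gamma_density (y + 1) n.+2%:R - gamma_density (y + 1) n.+2%:R^-1)%:E)%E.
Proof.
set f := fun t => y * gamma_density y t - gamma_density (y + 1) t.
have lt01 : (n.+2%:R^-1 : R) < n.+2%:R.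
  by rewrite (@lt_trans _ _ 1)// ?invf_lt1// ltr1n.
have pos t : t \in `[n.+2%:R^-1, n.+2%:R] -> 0 < t.
  by move=> h; exact: (@gamma_box_gt0 n).
have cont t : 0 < t -> {for t, continuous (gamma_density (y + 1))}.
  exact: continuous_gamma_density.
have Fdef := @continuous_FTC2 R f (gamma_density (y + 1)) _ _ lt01.
have {Fdef} : (\int[mu]_(t in gamma_box n) (f t)%:E =
    (gamma_density (y + 1) n.+2%:R)%:E - (gamma_density (y + 1) n.+2%:R^-1)%:E)%E.
  apply: Fdef.
  - apply: continuous_in_subspaceT => t /[!inE] /gamma_box_gt0 t0.
    apply: (@continuousB _ _ _ (fun t => y * gamma_density y t)); last exact: cont.
    apply: continuousM; first exact: cst_continuous.
    exact: continuous_gamma_density.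
  - split.
    + move=> t /subset_itv_oo_cc/pos t0.
      by have [] := is_derive_gamma_density y t0.
    + by apply: cvg_at_right_filter; apply: cont; rewrite invr_gt0.
    + by apply: cvg_at_left_filter; apply: cont.
  - move=> t /subset_itv_oo_cc/pos t0.
    by rewrite derive1E; have [_ ->] := is_derive_gamma_density y t0.
under eq_integral do rewrite EFinB EFinM.
have mB : measurable (gamma_box n) by exact: measurable_itv.
rewrite integralB//; last 2 first.
- by apply: integrableZl => //; exact: integrable_gamma_box.
- exact: integrable_gamma_box.
rewrite integralZl//; last exact: integrable_gamma_box.
set I := (\int[_]_(_ in _) _)%E; set J := (\int[_]_(_ in _) _)%E.
have /fineK <- : J \is a fin_num by apply: integrable_fin_num => //; exact: integrable_gamma_box.
have /fineK <- : I \is a fin_num by apply: integrable_fin_num => //; exact: integrable_gamma_box.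
rewrite -EFinM -!EFinB -EFinD => -[h]; congr (_%:E).
by rewrite -h addrC subrK.
Qed.

Lemma cvg_gamma_box y :
  (\int[mu]_(t in gamma_box n) (gamma_density y t)%:E @[n --> \oo] -->
   \int[mu]_(t in `]0%R, +oo[) (gamma_density y t)%:E)%E.
Proof.
rewrite -bigcup_gamma_box; apply: ge0_nondecreasing_set_cvg_integral.
- move=> m n mn; apply/subsetPset; apply: subset_itv; rewrite bnd_simp.
    by rewrite lef_pV2 ?posrE// ler_nat.
  by rewrite ler_nat.
- by move=> i; exact: measurable_itv.
- by move=> i; apply/measurable_EFinP; apply: measurable_gamma_density; exact: measurable_itv.
- by move=> i t _; rewrite lee_fin gamma_density_ge0.
Qed.

Lemma cvg_gamma_density_oo y : 1 <= y ->
  gamma_density y n.+2%:R @[n --> \oo] --> 0.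
Proof.
move=> y1; pose C := (2 * (y - 1 + 1)) `^ (y - 1).
have e1 : `|expR (- 2^-1 : R)| < 1 by rewrite ger0_norm ?expR_ge0// expR_lt1; lra.
have cE : C * expR (- 2^-1 : R) ^+ n.+2 @[n --> \oo] --> 0.
  rewrite -(mulr0 C); apply: cvgM; first exact: cvg_cst.
  exact: cvgn_shift2 (cvg_expr e1).
apply: (squeeze_cvgr _ (cvg_cst 0) cE); apply: nearW => n.
rewrite gamma_density_ge0/= /gamma_density.
have n0 : (0 : R) < n.+2%:R by [].
rewrite (le_trans (ler_wpM2r (expR_ge0 _) (powR_le_expR_half _ n0))) ?subr_ge0//.
rewrite -mulrA -expRD -expRM_natr le_eqVlt; apply/orP; left; apply/eqP; congr (_ * expR _).
by field.
Qed.

Lemma cvg_gamma_density_0 y : 0 < y -> gamma_density (y + 1) n.+2%:R^-1 @[n --> \oo] --> 0.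
Proof.
move=> y0.
have u0 : ((n.+2%:R^-1 : R) @[n --> \oo] --> 0).
  by have := @cvg_harmonic R; rewrite -cvg_shiftS.
have : (n.+2%:R^-1 : R) `^ y @[n --> \oo] --> 0.
  have /cvg_at_rightP := powR_cvg0 y0.
  by move=> /(_ (fun n => n.+2%:R^-1)); apply; split=> // n; rewrite invr_gt0.
move=> cy; apply: (squeeze_cvgr _ (cvg_cst 0) cy); apply: nearW => n.
rewrite gamma_density_ge0/= /gamma_density addrK.
by rewrite ler_piMr ?powR_ge0// expR_le1 oppr_le0 invr_ge0.
Qed.

(** The boundary terms vanish in the limit, and monotone convergence applies
    to both nonnegative integrals. *)
Lemma integral_gamma_densityS y : 0 < y ->
  (y%:E * \int[mu]_(t in `]0%R, +oo[) (gamma_density y t)%:E =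
   \int[mu]_(t in `]0%R, +oo[) (gamma_density (y + 1) t)%:E)%E.
Proof.
move=> y0.
have h1 := cvgeZl (y := y%:E) erefl (@cvg_gamma_box y).
have h2 : ((gamma_density (y + 1) n.+2%:R - gamma_density (y + 1) n.+2%:R^-1)%:E @[n --> \oo] --> 0%:E)%E.
  apply: cvg_EFin; first exact: nearW.
  rewrite -[X in _ --> X](subr0 0).
  apply: cvgB; last exact: cvg_gamma_density_0.
  by apply: cvg_gamma_density_oo; lra.
have h3 : (y%:E * \int[mu]_(t in gamma_box n) (gamma_density y t)%:E @[n --> \oo] -->
    \int[mu]_(t in `]0%R, +oo[) (gamma_density (y + 1) t)%:E + 0)%E.
  rewrite (eq_cvg _ _ (gamma_box_by_parts y)).
  by apply: cvgeD h2; [exact: fin_num_adde_defl|exact: cvg_gamma_box].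
rewrite -[RHS]adde0; apply: cvg_unique h1 h3; exact: ereal_hausdorff.
Qed.

(** For [y < 1] finiteness is read off the functional equation, whose
    right-hand side is the integral at [y + 1 >= 1]. *)
Lemma integrable_gamma_density y : 0 < y ->
  mu.-integrable `]0, +oo[ (EFin \o gamma_density y).
Proof.
move=> y0; apply/integrableP; split.
  by apply/measurable_EFinP; apply: measurable_gamma_density; exact: measurable_itv.
under eq_integral => t _ do rewrite /= ger0_norm ?gamma_density_ge0//.
have : (\int[mu]_(t in `]0%R, +oo[) (gamma_density (y + 1) t)%:E < +oo)%E.
  apply: integrable_lty; first exact: measurable_itv.
  by apply: integrable_gamma_density_ge1; lra.
rewrite -integral_gamma_densityS//.
set I := (\int[_]_(_ in _) _)%E; have : (0 <= I)%E.
  by apply: integral_ge0 => t _; rewrite lee_fin gamma_density_ge0.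
by case: I => [r _ _|_|//]; rewrite ?ltry// gt0_muley ?lte_fin.
Qed.

Lemma Gamma_integralE y :
  Gamma_integral y = \int[mu]_(t in `]0%R, +oo[) gamma_density y t.
Proof. by []. Qed.

Lemma Gamma_integralS y : 0 < y -> Gamma_integral (y + 1) = y * Gamma_integral y.
Proof.
move=> y0; rewrite !Gamma_integralE /Rintegral -integral_gamma_densityS//.
rewrite fineM//; apply: integrable_fin_num; first exact: measurable_itv.
exact: integrable_gamma_density.
Qed.

End GammaIntegral.

(** * The reciprocal Gamma function and its Lipschitz bounds *)

Section GammaBounds.
Context {R : realType}.
Implicit Types (t y z p : R) (n : nat).

Local Notation mu := (@lebesgue_measure R).

Lemma Gamma_integral1 : Gamma_integral (1 : R) = 1.
Proof.
rewrite Gamma_integralE /Rintegral -[RHS]/(fine (1 : \bar R)).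
rewrite -(integral_exponential_pdf (ltr01 : 0 < (1 : R))).
congr fine.
transitivity (\int[mu]_(t in `[0%R, +oo[) (gamma_density 1 t)%:E)%E.
  rewrite integral_itv_obnd_cbnd//.
  by apply/measurable_EFinP; apply: measurable_gamma_density; exact: measurable_itv.
rewrite integral_mkcond; apply: eq_integral => t _.
rewrite /exponential_pdf /patch; case: ifP => // _.
by rewrite /gamma_density subrr powRr0 mul1r mul1r mulN1r.
Qed.

Lemma ln_ge_1subV t : 0 < t -> 1 - t^-1 <= ln t.
Proof.
move=> t0; have := @le_ln1Dx R (t^-1 - 1).
rewrite (addrC 1) subrK lnV ?posrE// => /(_ ltac:(rewrite ltrBrDl subrr invr_gt0//)).
lra.
Qed.

Lemma ln_le_sub1 t : 0 < t -> ln t <= t - 1.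
Proof.
move=> t0; have := @le_ln1Dx R (t - 1).
by rewrite (addrC 1) subrK => ->//; rewrite ltrBrDl subrr.
Qed.

Lemma gamma_densityM y t : 0 < t -> gamma_density (y + 1) t = t * gamma_density y t.
Proof.
move=> t0; rewrite /gamma_density mulrA; congr (_ * _).
rewrite (_ : y + 1 - 1 = 1 + (y - 1)); last by ring.
by rewrite (@powRD _ t 1 (y - 1)) ?powRr1 ?ltW// (lt0r_neq0 t0) implybT.
Qed.

(** This is [e^u >= 1 + u] for the ratio [e^u] of the two densities. *)
Lemma gamma_density_tangent y z t : 0 < t ->
  (z - y) * ln t * gamma_density y t <= gamma_density z t - gamma_density y t.
Proof.
move=> t0.
have -> : gamma_density z t = expR ((z - y) * ln t) * gamma_density y t.
  rewrite /gamma_density mulrA; congr (_ * _).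
  by rewrite /powR !gt_eqF// -expRD; congr expR; ring.
rewrite -[X in _ <= _ - X]mul1r -mulrBl ler_wpM2r ?gamma_density_ge0//.
by have := expR_ge1Dx ((z - y) * ln t); lra.
Qed.

Lemma Rintegral_gamma_densityB y z : 0 < y -> 0 < z ->
  \int[mu]_(t in `]0%R, +oo[) (gamma_density y t - gamma_density z t) =
  Gamma_integral y - Gamma_integral z.
Proof.
by move=> y0 z0; rewrite RintegralB//; exact: integrable_gamma_density.
Qed.

Lemma integrable_gamma_densityB y z : 0 < y -> 0 < z ->
  mu.-integrable `]0, +oo[ (EFin \o (fun t => gamma_density y t - gamma_density z t)).
Proof.
move=> y0 z0; rewrite (_ : _ \o _ = (fun t => (gamma_density y t)%:E - (gamma_density z t)%:E)%E)//.
by apply: integrableB => //; exact: integrable_gamma_density.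
Qed.

Lemma le_Rintegral_gamma_densityB (c : R) y z y' z' : 0 < y -> 0 < z -> 0 < y' -> 0 < z' ->
  (forall t, 0 < t ->
    c * (gamma_density y t - gamma_density z t) <= gamma_density y' t - gamma_density z' t) ->
  c * (Gamma_integral y - Gamma_integral z) <= Gamma_integral y' - Gamma_integral z'.
Proof.
move=> y0 z0 y'0 z'0 le_c.
have m0 : measurable (`]0, +oo[ : set R) by exact: measurable_itv.
rewrite -Rintegral_gamma_densityB// -[leRHS]Rintegral_gamma_densityB//.
rewrite -RintegralZl//; last exact: integrable_gamma_densityB.
apply: le_Rintegral => //.
- rewrite (_ : _ \o _ = (fun t => c%:E * (gamma_density y t - gamma_density z t)%:E)%E)//.
  by apply: integrableZl => //; exact: integrable_gamma_densityB.
- exact: integrable_gamma_densityB.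
- by move=> t /=; rewrite in_itv/= andbT; exact: le_c.
Qed.

(** The tangent inequality for the densities combined with [ln t >= 1 - 1/t],
    integrated over [t]: a convexity bound that takes no derivative of Gamma. *)
Lemma Gamma_integral_slope_ge y z : 1 < y -> y <= z ->
  (z - y) * (Gamma_integral y - Gamma_integral (y - 1)) <=
  Gamma_integral z - Gamma_integral y.
Proof.
move=> y1 yz; apply: le_Rintegral_gamma_densityB; try lra.
move=> t t0; apply: le_trans (gamma_density_tangent y z t0).
rewrite -mulrA ler_wpM2l ?subr_ge0//.
have := @gamma_densityM (y - 1) _ t0; rewrite subrK => ->.
set g := gamma_density _ t.
have -> : t * g - g = (1 - t^-1) * (t * g) by field; exact: lt0r_neq0.
by rewrite ler_wpM2r ?ln_ge_1subV// mulr_ge0 ?(ltW t0)// gamma_density_ge0.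
Qed.

(** As for the lower bound, now with [ln t <= t - 1] and the tangent at [z]. *)
Lemma Gamma_integral_slope_le y z : 0 < y -> y <= z ->
  Gamma_integral z - Gamma_integral y <=
  (z - y) * (Gamma_integral (z + 1) - Gamma_integral z).
Proof.
move=> y1 yz; rewrite -lerN2 -mulNr [leRHS]opprB.
apply: le_Rintegral_gamma_densityB; try lra.
move=> t t0; apply: le_trans (gamma_density_tangent z y t0).
rewrite gamma_densityM//; set g := gamma_density _ t.
have g0 : 0 <= g by exact: gamma_density_ge0.
have l0 : 0 <= t - 1 - ln t by rewrite subr_ge0 ln_le_sub1.
have := mulr_ge0 (mulr_ge0 (ltac:(lra) : 0 <= z - y) g0) l0; nra.
Qed.

Lemma Gamma_integral2 : Gamma_integral (2 : R) = 1.
Proof. by rewrite -[2]/(1 + 1) Gamma_integralS// Gamma_integral1 mulr1. Qed.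

Lemma Gamma_integral_ge1 y : 2 <= y -> 1 <= Gamma_integral y.
Proof.
move=> y2; have := @Gamma_integral_slope_ge 2 y ltac:(lra) y2.
rewrite Gamma_integral2 (_ : 2 - 1 = 1) ?Gamma_integral1; last by ring.
by rewrite subrr mulr0 subr_ge0.
Qed.

(** The slope is at least [Gamma y - Gamma (y - 1) = (y - 2) Gamma (y - 1)],
    which is nonnegative from [y = 2] on. *)
Lemma Gamma_integral_le y z : 2 <= y -> y <= z -> Gamma_integral y <= Gamma_integral z.
Proof.
move=> y2 yz; rewrite -subr_ge0; apply: le_trans (Gamma_integral_slope_ge _ yz); last by lra.
apply: mulr_ge0; first by rewrite subr_ge0.
have e := @Gamma_integralS R (y - 1) ltac:(lra); rewrite subrK in e; rewrite e.
have -> : (y - 1) * Gamma_integral (y - 1) - Gamma_integral (y - 1) =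
  (y - 2) * Gamma_integral (y - 1) by ring.
apply: mulr_ge0; first by lra.
by apply: Rintegral_ge0 => t _; exact: gamma_density_ge0.
Qed.

Lemma Gamma_integral_ge_linear y : 2 <= y -> y <= 3 * Gamma_integral y.
Proof.
move=> y2; have [y3|y3] := leP y 3.
  by have := Gamma_integral_ge1 y2; lra.
have e := @Gamma_integralS R (y - 1) ltac:(lra); rewrite subrK in e; rewrite e.
have := @Gamma_integral_ge1 (y - 1) ltac:(lra); nra.
Qed.

Definition rgamma y : R := (Gamma y)^-1.

Lemma Gamma_gt0E y : 0 < y -> Gamma y = Gamma_integral y.
Proof. by move=> y0; rewrite /Gamma y0. Qed.

(** At [y = 0] both sides vanish because of the convention at the poles, and
    for [-1 < y <= 0] this is how Gamma is extended. *)
Lemma rgammaE y : -1 < y -> rgamma y = y * rgamma (y + 1).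
Proof.
move=> y1; rewrite /rgamma [Gamma (y + 1)]Gamma_gt0E; last by lra.
rewrite /Gamma; case: ifPn => [y0|].
  rewrite Gamma_integralS// invfM mulrA mulfV ?mul1r//; exact: lt0r_neq0.
rewrite -leNgt => y0.
have -> : Num.truncn (- y) = 0%N.
  apply/eqP; rewrite -leqn0 -ltnS.
  by rewrite truncn_lt_nat ?oppr_ge0//; lra.
by rewrite big_ord_recl big_ord0 /= mulr1 addr0 invfM invrK mulrC.
Qed.

Lemma rgamma_ge2 y : 2 <= y -> 0 <= rgamma y <= 1.
Proof.
move=> y2; have h := Gamma_integral_ge1 y2.
rewrite /rgamma Gamma_gt0E ?invr_ge0 ?invf_le1; lra.
Qed.

(** The real-arithmetic core of the Lipschitz bound of 1/Gamma, with [A] and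
    [B] the values of Gamma at [y] and [z]: the slope bound is used for [z - y
    < 1], and [A, B >= 1] for the remaining pairs. *)
Lemma inv_lipschitz (A B y z : R) : 1 <= A -> A <= B -> 2 <= y -> y <= z ->
  y <= 3 * A -> B - A <= (z - y) * (z * B - B) ->
  `|A^-1 - B^-1| <= 3 * (z - y).
Proof.
move=> A1 AB y2 yz yA slope.
have gap : 0 <= A^-1 - B^-1 by rewrite subr_ge0 lef_pV2 ?posrE; lra.
rewrite ger0_norm//; have [zy|zy] := leP 1 (z - y).
  have iA : A^-1 <= 1 by rewrite invf_le1; lra.
  have iB : 0 <= B^-1 by rewrite invr_ge0; lra.
  lra.
have -> : A^-1 - B^-1 = (B - A) / (A * B) by field; rewrite !lt0r_neq0//; lra.
rewrite ler_pdivrMr; last by apply: mulr_gt0; lra.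
apply: (le_trans slope).
have -> : (z - y) * (z * B - B) = (z - y) * B * (z - 1) by ring.
have -> : 3 * (z - y) * (A * B) = (z - y) * B * (3 * A) by ring.
apply: ler_wpM2l; last by lra.
by apply: mulr_ge0; lra.
Qed.

Lemma rgamma_lipschitz_ge2_sym y z : 2 <= y -> y <= z ->
  `|rgamma y - rgamma z| <= 3 * (z - y).
Proof.
move=> y2 yz; have y0 : 0 < y by lra.
have z0 : 0 < z by lra.
rewrite /rgamma !Gamma_gt0E//; apply: inv_lipschitz => //.
- exact: Gamma_integral_ge1.
- exact: Gamma_integral_le.
- exact: Gamma_integral_ge_linear.
- by rewrite -Gamma_integralS//; exact: Gamma_integral_slope_le.
Qed.

Lemma rgamma_lipschitz_ge2 y z : 2 <= y -> 2 <= z ->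
  `|rgamma y - rgamma z| <= 3 * `|y - z|.
Proof.
move=> y2 z2; have [yz|/ltW zy] := leP y z.
  by rewrite [`|y - z|]distrC (@ger0_norm _ (z - y)) ?subr_ge0//; exact: rgamma_lipschitz_ge2_sym.
by rewrite distrC (@ger0_norm _ (y - z)) ?subr_ge0//; exact: rgamma_lipschitz_ge2_sym.
Qed.

(** Three steps of the functional equation move every [y >= -1/2] into [2,
    oo[, where 1/Gamma is bounded and Lipschitz. *)
Lemma rgammaE3 y : -1 < y -> rgamma y = y * (y + 1) * (y + 2) * rgamma (y + 3).
Proof.
move=> y1; rewrite rgammaE// [rgamma (y + 1)]rgammaE; last by lra.
rewrite (_ : y + 1 + 1 = y + 2); last by ring.
rewrite [rgamma (y + 2)]rgammaE; last by lra.
rewrite (_ : y + 2 + 1 = y + 3); last by ring.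
by rewrite !mulrA.
Qed.

Lemma cubic_bounds y z : 0 <= z -> - 2^-1 <= y <= 2 * z + 1 ->
  `|y ^+ 2 + y * z + z ^+ 2 + 3 * (y + z) + 2| <= 18 * (z + 1) ^+ 3 /\
  `|z * (z + 1) * (z + 2)| <= 2 * (z + 1) ^+ 3.
Proof.
move=> n0 /andP[ly yu].
pose m := z + 1; rewrite -/m; have m1 : 1 <= m by rewrite /m; lra.
have y2m : `|y| <= 2 * m by rewrite ler_norml /m; lra.
have mm : 0 <= m by lra.
have m23 : m ^+ 2 <= m ^+ 3 by rewrite [leRHS]exprS ler_peMl// exprn_ge0.
have m12 : m <= m ^+ 2 by rewrite expr2 ler_peMl.
have y2 : y ^+ 2 <= 4 * m ^+ 2.
  rewrite -real_normK ?num_real// (_ : 4 * m ^+ 2 = (2 * m) ^+ 2); last by ring.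
  by rewrite ler_sqr ?nnegrE// mulr_ge0.
have yz : `|y * z| <= 2 * m ^+ 2.
  rewrite normrM (ger0_norm n0) (_ : 2 * m ^+ 2 = 2 * m * m); last by ring.
  by apply: ler_pM => //; rewrite /m; lra.
have z2 : z ^+ 2 <= m ^+ 2 by rewrite ler_sqr ?nnegrE// /m; lra.
have zm : z <= m by rewrite /m; lra.
split.
  move: y2m yz; rewrite !ler_norml => /andP[? ?] /andP[? ?].
  have ? := sqr_ge0 y; have ? := sqr_ge0 z.
  by apply/andP; split; lra.
rewrite ger0_norm; last by rewrite !mulr_ge0//; lra.
rewrite (_ : 2 * m ^+ 3 = m * m * (2 * m)); last by ring.
apply: ler_pM; [by rewrite mulr_ge0| by lra|by apply: ler_wpM2r|by rewrite /m; lra].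
Qed.

(** Only a polynomial growth of the constant in [n] matters: it is absorbed by
    the factorials of the series below. The range of [y] contains every
    argument met when the parameter of such a series moves by at most 1/2. *)
Lemma rgamma_lipschitz_nat n y : - 2^-1 <= y <= 2 * n%:R + 1 ->
  `|rgamma y - rgamma n%:R| <= 24 * n.+1%:R ^+ 3 * `|y - n%:R|.
Proof.
rewrite -[n.+1%:R]natr1; have n0 : 0 <= n%:R :> R by [].
move: n0; move: (n%:R : R) => z z0 yz.
have [P0 Q0] := cubic_bounds z0 yz; move: yz => /andP[ly yu].
rewrite (@rgammaE3 y) 1?(@rgammaE3 z); try lra.
have /andP[g0 g1] : 0 <= rgamma (y + 3) <= 1 by apply: rgamma_ge2; lra.
have lip : `|rgamma (y + 3) - rgamma (z + 3)| <= 3 * `|y - z|.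
  rewrite (_ : y - z = (y + 3) - (z + 3)); last by ring.
  by apply: rgamma_lipschitz_ge2; lra.
move: (rgamma (y + 3)) (rgamma (z + 3)) g0 g1 lip => r s r0 r1 lip.
have -> : y * (y + 1) * (y + 2) * r - z * (z + 1) * (z + 2) * s =
  (y - z) * (y ^+ 2 + y * z + z ^+ 2 + 3 * (y + z) + 2) * r +
  z * (z + 1) * (z + 2) * (r - s) by ring.
rewrite (le_trans (ler_normD _ _))// !(normrM _ r) (normrM _ (r - s)) (normrM (y - z)).
rewrite (ger0_norm r0) (_ : 24 * (z + 1) ^+ 3 * `|y - z| =
  `|y - z| * (18 * (z + 1) ^+ 3) * 1 + 2 * (z + 1) ^+ 3 * (3 * `|y - z|)); last by ring.
apply: lerD; apply: ler_pM => //.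
by apply: ler_wpM2l.
Qed.

End GammaBounds.

(** * Differentiability of the reciprocal Gamma function at the natural numbers *)

Section GammaDerivative.
Context {R : realType}.
Implicit Types (t y z p : R) (n : nat).

Local Notation mu := (@lebesgue_measure R).

Lemma is_derive_gamma_density_param y t : 0 < t ->
  is_derive y 1 (fun y => gamma_density y t) (ln t * gamma_density y t).
Proof.
move=> t0; rewrite /gamma_density.
rewrite (_ : (fun y => _) = (fun y => expR ((y - 1) * ln t) * expR (- t))); last first.
  by apply/funext => w; rewrite /powR gt_eqF.
apply: is_derive_eq.
rewrite /powR gt_eqF// /GRing.scale/=; ring.
Qed.

Lemma powR_le1D4 p t : 0 < t -> 0 <= p <= 4 -> t `^ p <= 1 + t `^ 4.
Proof.
move=> t0 /andP[p0 p4]; have [t1|t1] := leP 1 t.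
  by rewrite (le_trans (ler_powR t1 p4))// lerDr.
have : t `^ p <= t `^ 0 by apply: ger_powR => //; rewrite t0 ltW.
by rewrite powRr0 => /le_trans; apply; rewrite lerDl powR_ge0.
Qed.

(** The dominating function for differentiation under the integral sign. The
    window [2 < y < 4] is centred at [3] so that [t^(y - 2)] stays bounded
    near [0], where it absorbs the singularity of [ln t]. *)
Lemma gamma_density_param_bound y t : 0 < t -> 2 < y < 4 ->
  `|ln t * gamma_density y t| <= 2 * (gamma_density 1 t + gamma_density 5 t).
Proof.
move=> t0 /andP[y2 y4].
have lnt : `|ln t| <= t + t^-1.
  have ti : 0 <= t^-1 by rewrite invr_ge0 ltW.
  have := ln_ge_1subV t0; have := ln_le_sub1 t0.
  by rewrite ler_norml => ? ?; apply/andP; split; lra.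
rewrite normrM (ger0_norm (gamma_density_ge0 _ _)).
rewrite (le_trans (ler_wpM2r (gamma_density_ge0 _ _) lnt))//.
rewrite /gamma_density subrr powRr0 -mulrDl !mulrA.
apply: ler_wpM2r; first exact: expR_ge0.
have tn0 : t != 0 by exact: lt0r_neq0.
have -> : (t + t^-1) * t `^ (y - 1) = t `^ y + t `^ (y - 2).
  have pD a b : t `^ (a + b) = t `^ a * t `^ b by rewrite powRD// tn0 implybT.
  rewrite mulrDl; congr (_ + _).
    by rewrite -[X in X * _](powRr1 (ltW t0)) -pD addrC subrK.
  by rewrite -[X in X * _](powR_inv1 (ltW t0)) -pD; congr (_ `^ _); ring.
rewrite (_ : 5 - 1 = 4); last by ring.
have := @powR_le1D4 y t t0 ltac:(lra).
have := @powR_le1D4 (y - 2) t t0 ltac:(lra).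
lra.
Qed.

(** One point suffices: the functional equation carries differentiability of
    1/Gamma to all natural numbers. *)
Lemma derivable_Gamma_integral3 : derivable (@Gamma_integral R) 3 1.
Proof.
have der t : 0 < t -> forall y, derivable (fun y => gamma_density y t) y 1.
  by move=> t0 y; have [] := is_derive_gamma_density_param y t0.
apply: (@derivable_under_integral R _ _ mu (fun y t => gamma_density y t) `]0, +oo[%classic _ 3 2 4 _ _ _
  (fun t => 2 * (gamma_density 1 t + gamma_density 5 t))) => //.
- by rewrite /= in_itv/=; apply/andP; split; lra.
- move=> y; rewrite /= in_itv/= => /andP[y2 y4]; apply: integrable_gamma_density; lra.
- by move=> y t _; rewrite /= in_itv/= andbT => t0; exact: der.
- by move=> t; rewrite mulr_ge0// addr_ge0// gamma_density_ge0.
- rewrite (_ : _ \o _ = (fun t => 2%:E * (gamma_density 1 t + gamma_density 5 t)%:E)%E)//.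
  apply: integrableZl => //.
  rewrite (_ : (fun t => _) = (fun t => (gamma_density 1 t)%:E + (gamma_density 5 t)%:E)%E)//.
  by apply: integrableD => //; exact: integrable_gamma_density.
- move=> y t; rewrite /= !in_itv/= andbT => y24 t0.
  rewrite partial1of2E.
  have [_ ->] := is_derive_gamma_density_param y t0.
  exact: gamma_density_param_bound.
Qed.

Lemma derivable_rgamma3 : derivable (@rgamma R) 3 1.
Proof.
apply: (@near_eq_derivable _ _ _ (fun y => (Gamma_integral y)^-1)).
  near=> y; rewrite /rgamma Gamma_gt0E//.
  by near: y; apply: lt_nbhsr.
apply: derivableV; last exact: derivable_Gamma_integral3.
by rewrite gt_eqF// (lt_le_trans ltr01)// Gamma_integral_ge1//; lra.
Unshelve. all: by end_near. Qed.

Lemma is_derive_rgamma_down n d : is_derive (n.+1%:R : R) 1 rgamma d ->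
  is_derive (n%:R : R) 1 rgamma (rgamma n.+1%:R + n%:R * d).
Proof.
move=> dn.
apply: (@near_eq_is_derive _ _ _ (fun y => y * (rgamma \o (fun y => y + 1)) y)).
  near=> y; rewrite /= -rgammaE//.
  by near: y; apply: lt_nbhsr; rewrite (@lt_le_trans _ _ 0)//; lra.
have dn' : is_derive (n%:R + 1 : R) 1 rgamma d by rewrite natr1.
by apply: is_derive_eq; rewrite /GRing.scale/= natr1; ring.
Unshelve. all: by end_near. Qed.

Lemma is_derive_rgamma_up n d : is_derive (n.+1%:R : R) 1 rgamma d ->
  exists d', is_derive (n.+2%:R : R) 1 rgamma d'.
Proof.
move=> dn; have e : (n.+2%:R - 1 : R) = n.+1%:R by rewrite -natr1 addrK.
have dn' : is_derive (n.+2%:R - 1 : R) 1 rgamma d by rewrite e.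
have e0 : (n.+2%:R - 1 : R) != 0 by rewrite e.
eexists; apply: (@near_eq_is_derive _ _ _
    (fun y => (y - 1)^-1 * (rgamma \o (fun y => y - 1)) y)).
near=> y.
have y1 : 1 < y by near: y; apply: lt_nbhsr; rewrite ltr1n.
rewrite /= [rgamma (y - 1)]rgammaE; last by lra.
by rewrite subrK mulKf// gt_eqF// subr_gt0.
Unshelve. all: by end_near. Qed.

Lemma derivable_rgamma_nat n : derivable (@rgamma R) n%:R 1.
Proof.
have ex_d (a : R) : derivable rgamma a 1 <-> exists d, is_derive a 1 rgamma d.
  by split=> [/derivableP|[d []]//]; exists ('D_1 rgamma a).
suff h k : exists d, is_derive (k.+1%:R : R) 1 rgamma d.
  case: n => [|n]; last exact/ex_d.
  have [d /is_derive_rgamma_down d0] := h 0%N.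
  by apply/ex_d; eexists; exact: d0.
elim: k => [|k [d]]; last exact: is_derive_rgamma_up.
have d3 : is_derive (3%:R : R) 1 rgamma ('D_1 rgamma 3) := derivableP derivable_rgamma3.
by eexists; do 2 apply: is_derive_rgamma_down; exact: d3.
Qed.

Definition drgamma n : R := 'D_1 rgamma n%:R.

Lemma is_derive_rgamma n : is_derive (n%:R : R) 1 rgamma (drgamma n).
Proof. exact/derivableP/derivable_rgamma_nat. Qed.

(** The derivative of [G y = y G (y + 1)] for [G = 1/Gamma]; it replaces the
    recurrence of the digamma function. *)
Lemma drgammaE n : drgamma n = rgamma n.+1%:R + n%:R * drgamma n.+1.
Proof. by have [_] := is_derive_rgamma_down (is_derive_rgamma n.+1). Qed.

End GammaDerivative.

(** * Termwise differentiation of series *)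

Section TermwiseDerivative.
Context {R : realType}.
Implicit Types (u v M : R^nat).

Lemma cvg_series_dominated v M : (forall k, `|v k| <= M k) ->
  cvgn (series M) -> cvgn (series v).
Proof.
move=> vM cM; apply: normed_cvg.
by apply: series_le_cvg cM => // k; [exact: normr_ge0|exact: le_trans (vM k)].
Qed.

(** The tail estimate that makes the convergence of a dominated series uniform
    in a parameter. *)
Lemma series_tail_dominated v M N : (forall k, `|v k| <= M k) ->
  cvgn (series M) ->
  `|limn (series v) - series v N| <= limn (series M) - series M N.
Proof.
move=> vM cM; have cv := cvg_series_dominated vM cM.
have nc : `|series v n - series v N| @[n --> \oo] --> `|limn (series v) - series v N|.
  by apply: cvg_norm; apply: cvgB; [exact: cv|exact: cvg_cst].
have Mc : series M n - series M N @[n --> \oo] --> limn (series M) - series M N.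
  by apply: cvgB; [exact: cM|exact: cvg_cst].
rewrite -(cvg_lim _ nc)// -(cvg_lim _ Mc)//.
apply: ler_lim; [by apply/cvg_ex; eexists; exact: nc|by apply/cvg_ex; eexists; exact: Mc|].
near=> n.
have Nn : (N <= n)%N by near: n; exact: nbhs_infty_ge.
rewrite !sub_series_geq//.
by rewrite (le_trans (ler_norm_sum _ _ _))// ler_sum.
Unshelve. all: by end_near. Qed.

Lemma dist_le_eps4 (a a' b b' m e : R) : `|a - a'| <= m -> `|b - b'| <= m ->
  `|a' - b'| <= e / 4 -> m <= e / 4 -> `|a - b| <= e.
Proof. by rewrite !ler_norml => /andP[? ?] /andP[? ?] /andP[? ?] ?; lra. Qed.

Lemma is_derive1_quotientP (f : R -> R) (a d : R) :
  is_derive a 1 f d <-> h^-1 * (f (a + h) - f a) @[h --> 0^'] --> d.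
Proof.
have E : (fun h => h^-1 *: ((f \o shift a) (h *: 1) - f a)) =
         (fun h => h^-1 * (f (a + h) - f a)).
  by apply/funext => h; rewrite /shift/= [h *: 1]mulr1 (addrC h).
split=> [[df <-]|cf].
  by rewrite -E; exact: df.
by apply: DeriveDef; rewrite ?/derivable ?/derive E; [apply/cvg_ex; exists d|exact: cvg_lim].
Qed.

(** Domination of the difference quotients at the single point [a] is enough:
    it bounds the tails of the series of quotients uniformly, and finitely
    many terms are handled by their own derivatives. *)
Lemma is_derive_series (u : nat -> R -> R) (d M : R^nat) (a e : R) :
  0 < e ->
  (forall k, is_derive a 1 (u k) (d k)) ->
  cvgn (series (fun k => u k a)) ->
  (forall k h, `|h| <= e -> `|u k (a + h) - u k a| <= M k * `|h|) ->
  cvgn (series M) ->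
  [/\ forall h, `|h| <= e -> cvgn (series (fun k => u k (a + h))),
      cvgn (series d) &
      is_derive a 1 (fun y => limn (series (fun k => u k y))) (limn (series d))].
Proof.
move=> e0 du cua lip cM.
pose q h k := h^-1 * (u k (a + h) - u k a).
have qM h : h != 0 -> `|h| <= e -> forall k, `|q h k| <= M k.
  move=> h0 he k; rewrite normrM normfV mulrC ler_pdivrMr ?normr_gt0//.
  exact: lip.
have cvq k : q h k @[h --> 0^'] --> d k.
  by have [+ _] := is_derive1_quotientP (u k) a (d k); apply; exact: du.
have dM k : `|d k| <= M k.
  have nc : `|q h k| @[h --> 0^'] --> `|d k| by apply: cvg_norm; exact: cvq.
  rewrite -(cvg_lim _ nc)//; apply: limr_le; first by apply/cvg_ex; eexists; exact: nc.
  near=> h; apply: qM.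
    by near: h; exact: nbhs_dnbhs_neq.
  by near: h; apply: dnbhs0_le.
have cuh h : `|h| <= e -> cvgn (series (fun k => u k (a + h))).
  move=> he.
  have cdiff : cvgn (series (fun k => u k (a + h) - u k a)).
    apply: (@cvg_series_dominated _ (fun k => M k * `|h|)); first by move=> k; exact: lip.
    rewrite (_ : (fun k => _) = (`|h| *: M)); last by apply/funext => k; rewrite mulrC.
    exact: is_cvg_seriesZ.
  rewrite (_ : (fun k => _) = (fun k => u k (a + h) - u k a) + (fun k => u k a)).
    exact: is_cvg_seriesD.
  by apply/funext => k; rewrite /GRing.add /= subrK.
have cd := cvg_series_dominated dM cM.
split; [exact: cuh|exact: cd|].
pose S y := limn (series (fun k => u k y)).
have qE h : h != 0 -> `|h| <= e -> h^-1 * (S (a + h) - S a) = limn (series (q h)).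
  move=> h0 he; have c1 := cuh h he.
  rewrite /S -lim_seriesB// (_ : q h = h^-1 *: (fun k => u k (a + h) - u k a))//.
  by rewrite lim_seriesZ//; exact: is_cvg_seriesB.
apply/is_derive1_quotientP.
apply/cvgrPdist_le => /= eps eps0.
have eps4 : 0 < eps / 4 by rewrite divr_gt0.
have [N _ /(_ _ (leqnn N)) tailN] : \forall N \near \oo, `|limn (series M) - series M N| <= eps / 4.
  by move/cvgrPdist_le : cM; apply.
(* N is fixed by the tail of M alone, so that it serves all small h *)
have cN : series (q h) N @[h --> 0^'] --> series d N.
  by rewrite /series/=; apply: cvg_big => [|k _]; [exact: add_continuous|exact: cvq].
move/cvgrPdist_le : cN => /(_ _ eps4) cN.
near=> h.
have h0 : h != 0 by near: h; exact: nbhs_dnbhs_neq.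
have he : `|h| <= e by near: h; apply: dnbhs0_le.
rewrite qE//.
have t1 := series_tail_dominated N (qM h h0 he) cM.
have t2 := series_tail_dominated N dM cM.
have t3 : `|series d N - series (q h) N| <= eps / 4 by near: h.
exact: (dist_le_eps4 t2 t1 t3 (le_trans (ler_norm _) tailN)).
Unshelve. all: by end_near. Qed.

End TermwiseDerivative.

(** * Series of reciprocal Gamma values *)

Section RgammaSeries.
Context {R : realType}.
Implicit Types (x h nu : R) (n : nat -> nat) (s : nat -> R).

Lemma rgamma_nat_ge0_le1 (m : nat) : 0 <= rgamma (m%:R : R) <= 1.
Proof.
case: m => [|[|m]]; last by apply: rgamma_ge2; rewrite ler_nat.
  by rewrite rgammaE ?mul0r ?lexx ?ler01//; lra.
by rewrite rgammaE ?mul1r; [apply: rgamma_ge2|]; lra.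
Qed.

Lemma natS_le_exp2 (k : nat) : (k.+1%:R : R) <= 2 ^+ k.
Proof. by rewrite -natrX ler_nat ltn_expl. Qed.

(** Covers both kinds of series that occur: the slopes are [s k = 1] when the
    order of a Bessel function varies and [s k = k] when the first parameter
    of the Wright function does. In both cases the Lipschitz constants are
    bounded by a multiple of [16^k], so that the exponential series at 16 |x|
    dominates. *)
Lemma is_derive_rgamma_series x s n :
  (forall k, 0 <= s k <= 2 * (n k)%:R + 1) -> (forall k, (n k <= k.+2)%N) ->
  [/\ forall h, `|h| <= 2^-1 ->
        cvgn (series (fun k => exp_coeff x k * rgamma ((n k)%:R + s k * h))),
      cvgn (series (fun k => exp_coeff x k * (s k * drgamma (n k)))) &
      is_derive (0 : R) 1
        (fun h => limn (series (fun k => exp_coeff x k * rgamma ((n k)%:R + s k * h))))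
        (limn (series (fun k => exp_coeff x k * (s k * drgamma (n k)))))].
Proof.
move=> sn nk.
pose u k h := exp_coeff x k * rgamma ((n k)%:R + s k * h).
(* 3240 = 24 * 3^3 * 5, from (n k).+1 <= 3 * 2^k and s k <= 5 * 2^k *)
pose M k := 3240 * exp_coeff (16 * `|x|) k.
have du k : is_derive (0 : R) 1 (u k) (exp_coeff x k * (s k * drgamma (n k))).
  have d0 : is_derive ((n k)%:R + s k * 0) 1 rgamma (drgamma (n k)).
    by rewrite mulr0 addr0; exact: is_derive_rgamma.
  have dl : is_derive (0 : R) 1 (fun h => (n k)%:R + s k * h) (s k).
    by apply: is_derive_eq; rewrite add0r mul1r /GRing.scale/= mulr1.
  rewrite [s k * _]mulrC.
  have dc := @is_derive1_comp _ rgamma (fun h => (n k)%:R + s k * h) _ _ _ d0 dl.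
  have : is_derive (0 : R) 1 (exp_coeff x k \*: (rgamma \o (fun h => (n k)%:R + s k * h)))
     (exp_coeff x k *: (drgamma (n k) * s k)) by exact: is_deriveZ.
  by [].
have cM : cvgn (series M) by apply: is_cvg_seriesZ; exact: is_cvg_series_exp_coeff.
have cu0 : cvgn (series (fun k => u k 0)).
  apply: (@cvg_series_dominated _ _ (exp_coeff `|x|)); last exact: is_cvg_series_exp_coeff.
  move=> k; rewrite /u mulr0 addr0 normrM /exp_coeff normrM normrX normfV normr_nat.
  rewrite ler_piMr ?divr_ge0 ?exprn_ge0//.
  by have /andP[? ?] := rgamma_nat_ge0_le1 (n k); rewrite ger0_norm.
have lip k h : `|h| <= 2^-1 -> `|u k (0 + h) - u k 0| <= M k * `|h|.
  move=> h2; have /andP[s0 s1] := sn k.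
  rewrite /u add0r mulr0 addr0 -mulrBr normrM.
  have hb : - 2^-1 <= h <= 2^-1 by rewrite -ler_norml.
  have := @rgamma_lipschitz_nat R (n k) ((n k)%:R + s k * h).
  have -> : (n k)%:R + s k * h - (n k)%:R = s k * h by rewrite addrC addKr.
  have yb : - 2^-1 <= (n k)%:R + s k * h <= 2 * (n k)%:R + 1.
    by move/andP: hb => [? ?]; have ? : 0 <= (n k)%:R :> R by []; apply/andP; split; nra.
  move=> /(_ yb); rewrite normrM (ger0_norm s0) => lipk.
  rewrite (le_trans (ler_wpM2l (normr_ge0 _) lipk))//.
  rewrite (mulrA _ (s k)) (mulrA `|exp_coeff x k|) ler_wpM2r//.
  have k2 := natS_le_exp2 k.
  have nk' : ((n k)%:R : R) <= k%:R + 2 by rewrite -natrD ler_nat addn2.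
  have k0 : 0 <= k%:R :> R by [].
  have nb : ((n k).+1%:R : R) <= 3 * 2 ^+ k by rewrite -natr1; rewrite -natr1 in k2; lra.
  have sb : s k <= 5 * 2 ^+ k by rewrite -natr1 in k2; lra.
  rewrite /M /exp_coeff/= normrM normrX normfV normr_nat exprMn.
  have -> : (16 : R) ^+ k = (2 ^+ k) ^+ 3 * 2 ^+ k.
    by rewrite (_ : 16 = 2 ^+ 4); [rewrite -exprSr -!exprM mulnC|ring].
  have -> : 3240 * ((2 ^+ k) ^+ 3 * 2 ^+ k * `|x| ^+ k / k`!%:R) =
    `|x| ^+ k / k`!%:R * (24 * (3 * 2 ^+ k) ^+ 3 * (5 * 2 ^+ k)) by ring.
  have n3 : (n k).+1%:R ^+ 3 <= (3 * 2 ^+ k) ^+ 3 :> R by rewrite lerXn2r ?nnegrE ?mulr_ge0 ?exprn_ge0.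
  have n0 : 0 <= (n k).+1%:R ^+ 3 :> R by rewrite exprn_ge0.
  have c0 : 0 <= `|x| ^+ k / k`!%:R by rewrite divr_ge0// exprn_ge0.
  by rewrite ler_wpM2l// ler_pM// ?mulr_ge0// ler_wpM2l.
have [c1 c2 c3] := @is_derive_series R u _ M 0 2^-1 ltac:(lra) du cu0 lip cM.
split => // h h2; have := c1 h h2; by rewrite add0r.
Qed.

Lemma limn_series_behead (v : R^nat) : v 0%N = 0 -> cvgn (series v) ->
  limn (series v) = limn (series (fun k => v k.+1)).
Proof.
move=> v0 cv; apply/esym/cvg_lim => //.
have : series v n.+1 @[n --> \oo] --> limn (series v) by rewrite cvg_shiftS.
apply: cvg_trans; apply: near_eq_cvg; apply: nearW => n.
by rewrite /series/= big_nat_recl// v0 add0r.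
Qed.

End RgammaSeries.

(** * The entire factor of the Bessel functions and the Wright function *)

Section BesselFactor.
Context {R : realType}.
Context (x : R).

Lemma limn_seriesM (v : R^nat) : cvgn (series v) ->
  x * limn (series v) = limn (series (fun k => x * v k)).
Proof. by move=> cv; exact: esym (lim_seriesZ x cv). Qed.

(** [besselI nu (2 sqrt x) = x^(nu/2) * bessel_factor nu]: the factor of the
    Bessel function that is real for real [x] and free of branches. *)
Definition bessel_factor (nu : R) : R :=
  limn (series (fun k => exp_coeff x k * rgamma (nu + k%:R + 1))).

(** The derivative of [bessel_factor] at [m - 1], where the terms are
    evaluated at natural numbers. *)
Definition bessel_factor_deriv (m : nat) : R :=
  limn (series (fun k => exp_coeff x k * drgamma (k + m)%N)).

(** The derivative at [a = 1] of [wright a 1 x], by termwise differentiation. *)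
Definition wright_deriv : R :=
  limn (series (fun k => exp_coeff x k * (k%:R * drgamma k.+1))).

Lemma is_derive_bessel_factor (m : nat) (nu : R) : (m <= 2)%N -> nu + 1 = m%:R ->
  [/\ forall h, `|h| <= 2^-1 ->
        cvgn (series (fun k => exp_coeff x k * rgamma (nu + h + k%:R + 1))),
      cvgn (series (fun k => exp_coeff x k * drgamma (k + m)%N)) &
      is_derive nu 1 bessel_factor (bessel_factor_deriv m)].
Proof.
move=> m2 num.
have argE (h : R) (k : nat) : (k + m)%:R + 1 * h = nu + h + k%:R + 1.
  by rewrite natrD -num; ring.
have [] := @is_derive_rgamma_series R x (fun=> 1) (fun k => (k + m)%N).
- by move=> k; have : 0 <= (k + m)%:R :> R by []; lra.
- by move=> k; rewrite -addn2 leq_add2l.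
move=> c1 c2 d; split.
- move=> h h2; move: (c1 h h2).
  by under eq_fun do rewrite argE.
- by move: c2; under eq_fun do rewrite mul1r.
- have {}d : is_derive (nu - nu) 1
     (fun h => limn (series (fun k => exp_coeff x k * rgamma ((k + m)%:R + 1 * h))))
     (bessel_factor_deriv m).
    rewrite subrr; apply: is_derive_eq; congr (limn (series _)).
    by apply/funext => k; rewrite mul1r.
  have ds : is_derive nu 1 (fun y => y - nu) 1.
    by apply: is_derive_eq; rewrite subr0.
  have := @is_derive1_comp R _ _ nu _ _ d ds; rewrite mulr1.
  rewrite (_ : _ \o _ = bessel_factor)//.
  apply/funext => y /=; rewrite /bessel_factor; congr (limn (series _)).
  by apply/funext => k; rewrite argE; congr (_ * rgamma _); ring.
Qed.

Lemma is_derive_wright :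
  cvgn (series (fun k => exp_coeff x k * (k%:R * drgamma k.+1))) /\
  is_derive (1 : R) 1 (fun a => wright a 1 x) wright_deriv.
Proof.
have argE (h : R) (k : nat) : k.+1%:R + k%:R * h = (1 + h) * k%:R + 1.
  by rewrite -natr1; ring.
have [] := @is_derive_rgamma_series R x (fun k => k%:R) S.
- by move=> k; rewrite -natr1; have : 0 <= k%:R :> R by []; lra.
- by [].
move=> c1 c2 d; split; first exact: c2.
have {}d : is_derive (1 - 1 : R) 1
     (fun h => limn (series (fun k => exp_coeff x k * rgamma (k.+1%:R + k%:R * h))))
     wright_deriv by rewrite subrr.
have ds : is_derive (1 : R) 1 (fun y : R => y - 1) 1.
  by apply: is_derive_eq; rewrite subr0.
have := @is_derive1_comp R _ _ 1 _ _ d ds; rewrite mulr1.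
rewrite (_ : _ \o _ = (fun a => wright a 1 x))//.
apply/funext => y /=; rewrite /wright; congr (limn (series _)).
apply/funext => k; rewrite argE (addrC 1 (y - 1)) subrK /exp_coeff/= /rgamma invfM mulrA.
by [].
Qed.

Lemma exp_coeffS k : k.+1%:R * exp_coeff x k.+1 = x * exp_coeff x k.
Proof.
rewrite /exp_coeff/= factS natrM invfM exprS.
have : k.+1%:R != 0 :> R by [].
have : k`!%:R != 0 :> R by rewrite pnatr_eq0 -lt0n fact_gt0.
by move: (k.+1%:R : R) (k`!%:R : R) => a b b0 a0; field; apply/andP.
Qed.

(** The symmetry [I_(-1) = I_1]: the first term on the left vanishes at the
    pole of Gamma, and the other terms match after a shift of the index. *)
Lemma bessel_factorN1 : bessel_factor (-1) = x * bessel_factor 1.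
Proof.
have [c1 _ _] := @is_derive_bessel_factor 2 1 isT ltac:(by []).
have [c0 _ _] := @is_derive_bessel_factor 0 (-1) isT ltac:(by rewrite addNr).
have h0 : `|0 : R| <= 2^-1 by rewrite normr0 invr_ge0.
move: (c1 0 h0) (c0 0 h0); under eq_fun do rewrite addr0.
under [in X in _ -> X -> _]eq_fun do rewrite addr0.
move=> cv1 cv0; rewrite /bessel_factor limn_series_behead//; last first.
  by rewrite addr0 addNr rgammaE ?mul0r ?mulr0; lra.
rewrite limn_seriesM//; congr (limn (series _)); apply/funext => k.
rewrite (_ : -1 + k.+1%:R + 1 = k.+1%:R); last by ring.
rewrite rgammaE; last by rewrite (@lt_le_trans _ _ 0)//; lra.
rewrite mulrCA mulrA exp_coeffS -natr1 -mulrA; congr (_ * (_ * rgamma _)); ring.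
Qed.

(** The term of index [k] on the left is the term of index [k + 1] on the
    right, as [(k + 1) x^(k+1) / (k+1)! = x x^k / k!]. *)
Lemma bessel_factor_deriv2 : x * bessel_factor_deriv 2 = wright_deriv.
Proof.
have [_ c2 _] := @is_derive_bessel_factor 2 1 isT ltac:(by []).
have [cw _] := is_derive_wright.
rewrite /wright_deriv limn_series_behead ?mul0r ?mulr0//.
rewrite limn_seriesM; last exact: c2.
congr (limn (series _)); apply/funext => k.
by rewrite [RHS]mulrCA [RHS]mulrA exp_coeffS addn2 [LHS]mulrA.
Qed.

(** The differentiated functional equation of 1/Gamma, term by term. *)
Lemma bessel_factor_deriv0 :
  bessel_factor_deriv 0 = bessel_factor 0 + wright_deriv.
Proof.
have [c1 _ _] := @is_derive_bessel_factor 1 0 isT ltac:(by rewrite add0r).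
have [cw _] := is_derive_wright.
have h0 : `|0 : R| <= 2^-1 by rewrite normr0 invr_ge0.
move: (c1 0 h0); under eq_fun do rewrite addr0.
move=> cv; rewrite -lim_seriesD//; congr (limn (series _)); apply/funext => k.
transitivity (exp_coeff x k * rgamma (0 + k%:R + 1) + exp_coeff x k * (k%:R * drgamma k.+1)); last by [].
by rewrite addn0 drgammaE mulrDr add0r natr1.
Qed.

End BesselFactor.

(** * Limits in the complex plane and polar form of the square root *)

Section ComplexLimits.
Context {R : realType}.
Implicit Types (f g : R -> R) (z : R[i]).

(** The rule of de l'Hospital in the form that only asks for derivatives at
    the point itself. *)
Lemma cvg_quotient_of_zeros f g (a df dg : R) : is_derive a 1 f df ->
  is_derive a 1 g dg -> f a = 0 -> g a = 0 -> dg != 0 ->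
  f y / g y @[y --> a^'] --> df / dg.
Proof.
move=> /is_derive1_quotientP cf /is_derive1_quotientP cg fa ga dg0.
have cq : (h^-1 * (f (a + h) - f a)) / (h^-1 * (g (a + h) - g a)) @[h --> 0^'] --> df / dg.
  by apply: cvgM => //; exact: cvgV.
apply/cvgrPdist_lt => /= e e0; move/cvgrPdist_lt : cq => /(_ e e0) [r r0 near0].
exists r => // y /= yr ya; have ya0 : y - a != 0 by rewrite subr_eq0.
have := near0 (y - a); rewrite /= sub0r normrN distrC => /(_ yr ya0).
rewrite (addrC a) subrK fa ga !subr0 invfM invrK mulrACA mulVf// mul1r.
by [].
Qed.

Lemma norm_complex_le (a b : R) : `|a +i* b| <= (`|a| + `|b|)%:C.
Proof.
rewrite normc_def lecR /= -ler_sqr ?nnegrE ?sqrtr_ge0 ?addr_ge0//.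
rewrite sqr_sqrtr ?addr_ge0 ?sqr_ge0// sqrrD !real_normK ?num_real//.
rewrite lerD2r lerDl mulrn_wge0// mulr_ge0//.
Qed.

Lemma cvg_complex {T : Type} (F : set_system T) {FF : Filter F} (f g : T -> R) (a b : R) :
  f t @[t --> F] --> a -> g t @[t --> F] --> b ->
  (f t +i* g t : R[i]^o) @[t --> F] --> (a +i* b : R[i]^o).
Proof.
move=> cf cg; apply/cvgrPdist_le => /= -[e e'].
rewrite ltcE /= => /andP[/eqP -> e0].
have e2 : 0 < e / 2 by rewrite divr_gt0.
move/cvgrPdist_le : cf => /(_ _ e2) cf; move/cvgrPdist_le : cg => /(_ _ e2) cg.
near=> t.
have ft : `|a - f t| <= e / 2 by near: t.
have gt : `|b - g t| <= e / 2 by near: t.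
rewrite (_ : _ - _ = (a - f t) +i* (b - g t)); last by [].
apply: (le_trans (norm_complex_le _ _)).
by rewrite complexr0 lecR; lra.
Unshelve. all: by end_near. Qed.

Lemma lim_complex {T : Type} (F : set_system T) {FF : ProperFilter F} (f g : T -> R) (a b : R) :
  f t @[t --> F] --> a -> g t @[t --> F] --> b ->
  lim ((f t +i* g t : R[i]^o) @[t --> F]) = a +i* b.
Proof. by move=> cf cg; apply: cvg_lim; [exact: norm_hausdorff|exact: cvg_complex]. Qed.

Lemma series_complexr (v : R^nat) n :
  series (fun k => (v k)%:C : R[i]^o) n = (series v n)%:C.
Proof. by rewrite /series/= raddf_sum. Qed.

Lemma limn_series_complexr (v : R^nat) : cvgn (series v) ->
  limn (series (fun k => (v k)%:C : R[i]^o)) = (limn (series v))%:C.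
Proof.
move=> cv; rewrite (_ : series _ = (fun n => series v n +i* 0)).
  by apply: lim_complex; [exact: cv|exact: cvg_cst].
by apply/funext => n; rewrite series_complexr.
Qed.

(** On the real axis the principal branches are compatible: [ln x = 2 ln (sqrt
    x)], which may fail for a square root of another branch. For [x < 0] the
    arguments are [pi] and [pi/2]. *)
Lemma sqrtc_real_polar (x : R) : x != 0 -> exists p q : R,
  [/\ lnc (sqrtc x%:C) = p +i* q, lnc x%:C = (2 * p) +i* (2 * q) &
      sqrtc x%:C = expc (p +i* q)].
Proof.
move=> x0; have [x_lt0|x_gt0|xE] := ltgtP x 0; last by rewrite xE eqxx in x0.
- pose y := Num.sqrt (- x); have y0 : 0 < y by rewrite sqrtr_gt0 oppr_gt0.
  have yy : y ^+ 2 = - x by rewrite sqr_sqrtr// oppr_ge0 ltW.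
  have normx : Num.sqrt (x ^+ 2 + 0 ^+ 2) = - x.
    by rewrite expr0n addr0 sqrtr_sqr ltr0_norm.
  have sE : sqrtc x%:C = 0 +i* y.
    rewrite /sqrtc /= eqxx mul1r normx addNr mul0r sqrtr0; congr (_ +i* Num.sqrt _).
    by field.
  have normy : Num.sqrt (0 ^+ 2 + y ^+ 2) = y by rewrite expr0n add0r sqrtr_sqr gtr0_norm.
  exists (ln y), (pi / 2); rewrite sE; split.
  + rewrite /lnc /Argc /= normy mul0r acos0 (ltW y0); congr (_ +i* _).
  + rewrite /lnc /Argc /= normx lexx (_ : x / - x = -1) ?acosN1; last by field.
    rewrite -yy lnXn// mulr_natl; congr (_ +i* _).
    by field.
  + rewrite /expc /= lnK ?posrE// cos_pihalf sin_pihalf.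
    by rewrite /GRing.mul/= !mulr0 mul0r subrr mulr1 addr0.
- pose y := Num.sqrt x; have y0 : 0 < y by rewrite sqrtr_gt0.
  have yy : y ^+ 2 = x by rewrite sqr_sqrtr// ltW.
  have sE : sqrtc x%:C = y%:C by rewrite sqrtc_sqrtr// ler0c ltW.
  have normp (w : R) : 0 < w -> Num.sqrt (w ^+ 2 + 0 ^+ 2) = w.
    by move=> w0; rewrite expr0n addr0 sqrtr_sqr gtr0_norm.
  exists (ln y), 0; rewrite sE; split.
  + by rewrite /lnc /Argc /= normp// lexx divff ?gt_eqF// acos1.
  + rewrite /lnc /Argc /= normp// lexx divff ?gt_eqF// acos1 mulr0.
    by rewrite -yy lnXn// mulr_natl.
  + by rewrite /expc /= lnK ?posrE// cos0 sin0 mulr1.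
Qed.

End ComplexLimits.

(** * The Bessel functions at twice the square root *)

Section BesselValues.
Context {R : realType}.
Implicit Types (x nu : R) (z : R[i]).

Lemma mulcE (a b c d : R) :
  (a +i* b) * (c +i* d) = (a * c - b * d) +i* (a * d + b * c).
Proof. by []. Qed.

Lemma expc_neq0 z : expc z != 0.
Proof.
rewrite /expc mulf_neq0//.
  by rewrite eq_complex /= expR_eq0.
apply/eqP => -[c0 s0]; have := cos2Dsin2 (complex.Im z).
by rewrite c0 s0 expr0n addr0 => /eqP; rewrite eq_sym oner_eq0.
Qed.

Lemma expcD z w : expc (z + w) = expc z * expc w.
Proof.
case: z => a b; case: w => c d; rewrite /expc /= expRD cosD sinD.
rewrite rmorphM/= mulrACA; congr (_ * _).
by rewrite mulcE; congr (_ +i* _); ring.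
Qed.

Lemma expc0 : expc (0 : R[i]) = 1.
Proof. by rewrite /expc /= expR0 cos0 sin0 mulr1. Qed.

Lemma expcN z : expc (- z) = (expc z)^-1.
Proof.
by apply: (mulfI (expc_neq0 z)); rewrite -expcD subrr expc0 mulfV// expc_neq0.
Qed.

Definition expc_Re (p q nu : R) := expR (nu * p) * cos (nu * q).
Definition expc_Im (p q nu : R) := expR (nu * p) * sin (nu * q).

Lemma expc_realZ p q nu :
  expc (nu%:C * (p +i* q)) = expc_Re p q nu +i* expc_Im p q nu.
Proof.
rewrite /expc /expc_Re /expc_Im.
have -> : nu%:C * (p +i* q) = (nu * p) +i* (nu * q).
  by rewrite mulcE !mul0r subr0 addr0.
by rewrite /= mulcE !mul0r subr0 addr0.
Qed.

Lemma is_derive_expc_Re p q nu : is_derive nu 1 (expc_Re p q)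
  (p * expc_Re p q nu - q * expc_Im p q nu).
Proof.
rewrite /expc_Re /expc_Im; apply: is_derive_eq.
by rewrite /GRing.scale/=; ring.
Qed.

Lemma is_derive_expc_Im p q nu : is_derive nu 1 (expc_Im p q)
  (p * expc_Im p q nu + q * expc_Re p q nu).
Proof.
rewrite /expc_Re /expc_Im; apply: is_derive_eq.
by rewrite /GRing.scale/=; ring.
Qed.

Lemma besselI_sqrt x nu : x != 0 ->
  cvgn (series (fun k => exp_coeff x k * rgamma (nu + k%:R + 1))) ->
  besselI nu (2 * sqrtc x%:C) =
  expc (nu%:C * lnc (sqrtc x%:C)) * (bessel_factor x nu)%:C.
Proof.
move=> x0 cv; rewrite /besselI.
have -> : 2 * sqrtc x%:C / 2 = sqrtc x%:C :> R[i].
  by rewrite mulrAC divff ?mul1r// pnatr_eq0.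
have s0 : sqrtc x%:C != 0 :> R[i] by rewrite sqrtc_eq0 eq_complex /= negb_and x0.
rewrite /powc (negbTE s0); congr (_ * _).
rewrite /bessel_factor -limn_series_complexr//.
apply: (congr1 (fun u : (R[i]^o)^nat => limn (series u))).
apply/funext => k; rewrite exprM sqr_sqrtc.
rewrite /exp_coeff/= /rgamma !rmorphM/= !fmorphV/= rmorphXn/= rmorph_nat.
by rewrite invfM mulrA.
Qed.

Lemma is_derive_sin_pi : is_derive (1 : R) 1 (fun mu => sin (mu * pi)) (- pi).
Proof.
apply: is_derive_eq; rewrite mul1r cospi /GRing.scale/=; ring.
Qed.

(** Up to a constant, the numerator of the formula for [besselK] is the odd
    part of [mu |-> besselI mu z], which is split here into a component [E] of
    the exponential and the real factor [H]. *)
Lemma is_derive_odd_part (E H : R -> R) (c e1 e0 h1 h0 : R) :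
  is_derive (1 : R) 1 E e1 -> is_derive (-1 : R) 1 E e0 ->
  is_derive (1 : R) 1 H h1 -> is_derive (-1 : R) 1 H h0 ->
  is_derive (1 : R) 1 (fun mu => c * (E (- mu) * H (- mu) - E mu * H mu))
    (c * (- (e0 * H (-1) + E (-1) * h0) - (e1 * H 1 + E 1 * h1))).
Proof.
move=> dE1 dE0 dH1 dH0.
have dN : is_derive (1 : R) 1 (fun mu : R => - mu) (-1) by apply: is_derive_eq.
have dE := @is_derive1_comp R E (fun mu => - mu) 1 _ _ dE0 dN.
have dH := @is_derive1_comp R H (fun mu => - mu) 1 _ _ dH0 dN.
have : is_derive (1 : R) 1
  (fun mu => c * ((E \o -%R) mu * (H \o -%R) mu - E mu * H mu))
  (c * (- (e0 * H (-1) + E (-1) * h0) - (e1 * H 1 + E 1 * h1))).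
  by apply: is_derive_eq; rewrite /GRing.scale/=; ring.
by [].
Qed.

(** Numerator and denominator of the defining quotient vanish at [mu = 1], so
    that the limit is the quotient of their derivatives. The limit is taken
    separately on the real and imaginary parts, which are real functions of
    the order; by [I_(-1) = I_1] the two logarithmic terms coincide and add up
    to [ln s * I_1]. *)
Lemma besselK1_sqrt x : x != 0 ->
  let s := sqrtc x%:C in
  besselK 1 (2 * s) =
    lnc s * s * (bessel_factor x 1)%:C
    + (s^-1 * (bessel_factor_deriv x 0)%:C + s * (bessel_factor_deriv x 2)%:C) / 2.
Proof.
move=> x0 s; have [p [q [ls _ sE]]] := sqrtc_real_polar x0.
rewrite -/s in ls sE.
have s0 : s != 0 by rewrite sE expc_neq0.
set A := expc_Re p q; set B := expc_Im p q.
set H := bessel_factor x.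
have [c1 _ d1] := @is_derive_bessel_factor R x 2 1 isT ltac:(by []).
have [c0 _ d0] := @is_derive_bessel_factor R x 0 (-1) isT ltac:(by rewrite addNr).
pose odd_part (E : R -> R) mu := pi / 2 * (E (- mu) * H (- mu) - E mu * H mu).
have powE nu : expc (nu%:C * lnc s) = A nu +i* B nu by rewrite ls expc_realZ.
have s1 : A 1 +i* B 1 = s by rewrite -powE ls mul1r -sE.
have sN1 : A (-1) +i* B (-1) = s^-1.
  by rewrite -powE ls rmorphN1 mulN1r expcN -sE.
have HN1 : H (-1) = x * H 1 by exact: bessel_factorN1.
have ss : s * s = x%:C by rewrite -expr2 sqr_sqrtc.
have zeroC : s^-1 * (H (-1))%:C - s * (H 1)%:C = 0.
  by rewrite HN1 rmorphM/= -ss !mulrA mulVf// mul1r subrr.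
have [zA zB] : A (-1) * H (-1) = A 1 * H 1 /\ B (-1) * H (-1) = B 1 * H 1.
  move: zeroC; rewrite -sN1 -s1 !mulcE !mulr0 !subr0 !add0r => /eqP.
  rewrite eq_complex /= => /andP[/eqP/subr0_eq zA /eqP/subr0_eq zB].
  by split.
have odd0 (E : R -> R) : E (-1) * H (-1) = E 1 * H 1 -> odd_part E 1 = 0.
  by move=> e; rewrite /odd_part e subrr mulr0.
have pi0 : - pi != 0 :> R by rewrite oppr_eq0 gt_eqF// pi_gt0.
have sin1 : sin (1 * pi) = 0 :> R by rewrite mul1r sinpi.
have limA := cvg_quotient_of_zeros
  (is_derive_odd_part (pi / 2) (is_derive_expc_Re p q 1) (is_derive_expc_Re p q (-1)) d1 d0)
   is_derive_sin_pi (odd0 A zA) sin1 pi0.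
have limB := cvg_quotient_of_zeros
  (is_derive_odd_part (pi / 2) (is_derive_expc_Im p q 1) (is_derive_expc_Im p q (-1)) d1 d0)
   is_derive_sin_pi (odd0 B zB) sin1 pi0.
(* besselI is a product at both mu and - mu once mu is within 1/2 of 1 *)
have formulaE : \forall mu \near (1 : R)^',
    odd_part A mu / sin (mu * pi) +i* (odd_part B mu / sin (mu * pi)) =
    besselK_formula mu (2 * s).
  near=> mu.
  have mu1 : `|mu - 1| <= 2^-1.
    near: mu; exists 2^-1 => /=; first by rewrite invr_gt0.
    by move=> y /=; rewrite distrC => /ltW.
  rewrite /besselK_formula !besselI_sqrt//; last 2 first.
  - have := c1 (mu - 1) mu1.
    by under eq_fun do rewrite addrCA subrr addr0.
  - have := c0 (1 - mu); rewrite distrC => /(_ mu1).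
    by under eq_fun do rewrite addrA addNr add0r.
  rewrite -/s -/H !powE -fmorphV /odd_part.
  rewrite !mulcE.
  move: (A mu) (A (- mu)) (B mu) (B (- mu)) (H mu) (H (- mu)) (sin (mu * pi))^-1 => *.
  by congr (_ +i* _); ring.
rewrite /besselK int_num1.
have cvgK : (besselK_formula mu (2 * s) : R[i]^o) @[mu --> (1 : R)^'] --> (_ : R[i]^o) :=
  cvg_trans (near_eq_cvg formulaE) (cvg_complex limA limB).
rewrite (cvg_lim (@norm_hausdorff _ _) (cvgK _ _)).
have halfpi (c X : R) : - c != 0 -> c / 2 * X / - c = - X / 2.
  by rewrite oppr_eq0 => cn0; field.
rewrite !halfpi// -/A -/B -/H.
have -> : (p * A (-1) - q * B (-1)) * H (-1) = (p * A 1 - q * B 1) * H 1.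
  by rewrite !mulrBl -(mulrA p) -(mulrA q) zA zB !mulrA.
have -> : (p * B (-1) + q * A (-1)) * H (-1) = (p * B 1 + q * A 1) * H 1.
  by rewrite !mulrDl -(mulrA p) -(mulrA q) zA zB !mulrA.
rewrite ls (_ : 2^-1 = (2^-1)%:C :> R[i]); last by rewrite fmorphV rmorph_nat.
rewrite -sN1 -s1 !mulcE.
move: (bessel_factor_deriv x 0) (bessel_factor_deriv x 2) (A 1) (B 1) (A (-1)) (B (-1)) (H 1).
by move=> *; congr (_ +i* _); field.
Unshelve. all: by end_near. Qed.

End BesselValues.

(** * The derivative of the Wright function *)

Theorem theorem6p5 (R : realType) (x : R) (hx : x != 0) :
  derivable (fun a : R => wright a 1 x) 1 1 /\
  ((derive1 (fun a : R => wright a 1 x) 1)%:C : R[i]) =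
    (sqrtc x%:C * (2 * besselK 1 (2 * sqrtc x%:C)
                   - lnc x%:C * besselI 1 (2 * sqrtc x%:C))
     - besselI 0 (2 * sqrtc x%:C)) / 2.
Proof.
have [_ [dW WE]] := is_derive_wright x; split=> //.
rewrite derive1E WE besselK1_sqrt//.
have h0 : `|0 : R| <= 2^-1 by rewrite normr0 invr_ge0.
have [/(_ 0 h0) c1 _ _] := @is_derive_bessel_factor R x 2 1 isT ltac:(by []).
have [/(_ 0 h0) c0 _ _] := @is_derive_bessel_factor R x 1 0 isT ltac:(by rewrite add0r).
rewrite !addr0 in c1 c0.
rewrite !besselI_sqrt//.
rewrite mul0r expc0 mul1r rmorph1 mul1r.
have [p [q [ls lx sE]]] := sqrtc_real_polar hx.
have -> : lnc x%:C = 2 * lnc (sqrtc x%:C).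
  by rewrite lx ls mulr_natl mulr2n !mulr_natl !mulr2n.
have s0 : sqrtc x%:C != 0 by rewrite sE expc_neq0.
have ss : sqrtc x%:C * sqrtc x%:C = x%:C by rewrite -expr2 sqr_sqrtc.
have D0 := congr1 (real_complex R) (bessel_factor_deriv0 x).
have D2 := congr1 (real_complex R) (bessel_factor_deriv2 x).
rewrite rmorphD/= in D0; rewrite rmorphM/= -ss in D2.
have el : expc (lnc (sqrtc x%:C)) = sqrtc x%:C by rewrite ls -sE.
rewrite el D0 -D2.
move: s0; move: (sqrtc x%:C) (lnc (sqrtc x%:C)) => s l s0.
by field.
Qed.
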